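(* For $i=1,2$ let $\mathcal{H}_i\subseteq\mathcal{K}_i$ be complex Hilbert spaces, let $T_i\in\mathcal{B}(\mathcal{H}_i)$ be a contraction and let $V_i\in\mathcal{B}(\mathcal{K}_i)$ be an isometric lifting of $T_i$. Let $X\in\mathcal{B}(\mathcal{H}_1,\mathcal{H}_2)$. Suppose $Q\in\mathcal{B}(\mathcal{H}_2)$ and $\overline{Q}\in\mathcal{B}(\mathcal{K}_2)$ are contractions with $\mathcal{H}_2$ reducing $\overline{Q}$ and $\overline{Q}|_{\mathcal{H}_2}=Q$. (i) If $XT_1=QT_2X$, then there exists a lifting $Y\in\mathcal{B}(\mathcal{K}_1,\mathcal{K}_2)$ of $X$ such that $YV_1=\overline{Q}V_2Y$. (ii) If $XT_1=T_2QX$, then there exists a lifting $Y\in\mathcal{B}(\mathcal{K}_1,\mathcal{K}_2)$ of $X$ such that $YV_1=V_2\overline{Q}Y$. Suppose instead $Q\in\mathcal{B}(\mathcal{H}_1)$ and $\overline{Q}\in\mathcal{B}(\mathcal{K}_1)$ are unitaries with $\mathcal{H}_1$ reducing $\overline{Q}$ and $\overline{Q}|_{\mathcal{H}_1}=Q$. (iii) If $XT_1=T_2XQ$, then there exists a lifting $Y\in\mathcal{B}(\mathcal{K}_1,\mathcal{K}_2)$ of $X$ such that $YV_1=V_2Y\overline{Q}$. In all cases $T_2^nX=P_{\mathcal{H}_2}V_2^nY|_{\mathcal{H}_1}$ and $XT_1^n=P_{\mathcal{H}_2}YV_1^n|_{\mathcal{H}_1}$ for all integers $n\geq 0$, and $Y$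 can be chosen such that $\|Y\|=\|X\|$.
   Context: For Hilbert spaces $\mathcal{H}_1\subseteq\mathcal{K}_1$, $\mathcal{H}_2\subseteq\mathcal{K}_2$, an operator $S\in\mathcal{B}(\mathcal{K}_1,\mathcal{K}_2)$ is a lifting of $T\in\mathcal{B}(\mathcal{H}_1,\mathcal{H}_2)$ if $S(\mathcal{H}_1^\perp)\subseteq\mathcal{H}_2^\perp$ and $T=P_{\mathcal{H}_2}S|_{\mathcal{H}_1}$ (equivalently $S^*|_{\mathcal{H}_2}=T^*$). An isometric lifting of a contraction is a lifting that is an isometry. $P_{\mathcal{H}_2}$ is the orthogonal projection onto $\mathcal{H}_2$. *)

(* Defs.v *)
From HB Require Import structures.
From mathcomp Require Import all_boot all_order all_algebra.
From mathcomp Require Import classical_sets reals.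
From mathcomp Require Import complex.
Set Implicit Arguments. Unset Strict Implicit. Unset Printing Implicit Defensive.
Import Order.TTheory GRing.Theory Num.Theory.
Local Open Scope ring_scope.
Local Open Scope classical_set_scope.

Section Hilbert.
Variable R : realType.
Local Notation C := (R[i]).

Definition is_inner_product (V : lmodType C) (ip : V -> V -> C) : Prop :=
  [/\ forall (a : C) (x y z : V), ip (a *: x + y) z = a * ip x z + ip y z,
      forall x y : V, ip y x = (ip x y)^*,
      forall x : V, 0 <= ip x x
    & forall x : V, ip x x = 0 -> x = 0].

Definition hnorm (V : lmodType C) (ip : V -> V -> C) (x : V) : R :=
  Num.sqrt (complex.Re (ip x x)).

Definition hcomplete (V : lmodType C) (ip : V -> V -> C) : Prop :=
  forall u : nat -> V,
    (forall e : R, 0 < e -> exists N, forall m n, (N <= m)%N -> (N <= n)%N ->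
        hnorm ip (u m - u n) < e) ->
    exists l : V, forall e : R, 0 < e -> exists N, forall n, (N <= n)%N ->
        hnorm ip (u n - l) < e.

Definition is_hilbert (V : lmodType C) (ip : V -> V -> C) : Prop :=
  is_inner_product ip /\ hcomplete ip.

Variables (V W : lmodType C) (ipV : V -> V -> C) (ipW : W -> W -> C).

Definition hbounded_op (A : V -> W) : Prop :=
  (forall (a : C) (x y : V), A (a *: x + y) = a *: A x + A y) /\
  exists M : R, forall x, hnorm ipW (A x) <= M * hnorm ipV x.

Definition opnorm (A : V -> W) : R :=
  sup [set hnorm ipW (A x) | x in [set x | hnorm ipV x <= 1]].

Definition hisometry (A : V -> W) : Prop :=
  forall x, hnorm ipW (A x) = hnorm ipV x.

Definition hcontraction (A : V -> W) : Prop :=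
  hbounded_op A /\ forall x, hnorm ipW (A x) <= hnorm ipV x.
End Hilbert.

Definition hunitary (R : realType) (V : lmodType R[i]) (ip : V -> V -> R[i])
  (A : V -> V) : Prop :=
  [/\ hbounded_op ip ip A, hisometry ip ip A & forall y, exists x, A x = y].

(* Subspaces: a Hilbert space H contained in a Hilbert space K is given by
   a linear map J : H -> K preserving inner products (the inclusion). *)
Section Sub.
Variable R : realType.
Local Notation C := (R[i]).

Definition hembedding (H K : lmodType C) (ipH : H -> H -> C) (ipK : K -> K -> C)
  (J : H -> K) : Prop :=
  (forall (a : C) (x y : H), J (a *: x + y) = a *: J x + J y) /\
  forall x y, ipK (J x) (J y) = ipH x y.

Definition in_perp (H K : lmodType C) (ipK : K -> K -> C) (J : H -> K) (k : K) : Prop :=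
  forall h : H, ipK k (J h) = 0.

(* P_{H2} k = J2 h  (h is the H2-component of k): k - J2 h is orthogonal to H2 *)
Definition proj_is (H K : lmodType C) (ipK : K -> K -> C) (J : H -> K)
  (k : K) (h : H) : Prop :=
  in_perp ipK J (k - J h).

Definition is_lifting (H1 K1 H2 K2 : lmodType C)
  (ipK1 : K1 -> K1 -> C) (ipK2 : K2 -> K2 -> C)
  (J1 : H1 -> K1) (J2 : H2 -> K2) (S : K1 -> K2) (T : H1 -> H2) : Prop :=
  (forall k, in_perp ipK1 J1 k -> in_perp ipK2 J2 (S k)) /\
  (forall h, proj_is ipK2 J2 (S (J1 h)) (T h)).

Definition reduces_to (H K : lmodType C) (ipK : K -> K -> C) (J : H -> K)
  (Qbar : K -> K) (Q : H -> H) : Prop :=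
  (forall h, Qbar (J h) = J (Q h)) /\
  (forall k, in_perp ipK J k -> in_perp ipK J (Qbar k)).
End Sub.

Definition good_lift (R : realType) (H1 K1 H2 K2 : lmodType R[i])
  (ipH1 : H1 -> H1 -> R[i]) (ipK1 : K1 -> K1 -> R[i])
  (ipH2 : H2 -> H2 -> R[i]) (ipK2 : K2 -> K2 -> R[i])
  (J1 : H1 -> K1) (J2 : H2 -> K2) (T1 : H1 -> H1) (T2 : H2 -> H2)
  (V1 : K1 -> K1) (V2 : K2 -> K2) (X : H1 -> H2) (Y : K1 -> K2) : Prop :=
  [/\ hbounded_op ipK1 ipK2 Y,
      is_lifting ipK1 ipK2 J1 J2 Y X,
      forall (n : nat) (h : H1), proj_is ipK2 J2 (iter n V2 (Y (J1 h))) (iter n T2 (X h)),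
      forall (n : nat) (h : H1), proj_is ipK2 J2 (Y (iter n V1 (J1 h))) (X (iter n T1 h))
    & opnorm ipK1 ipK2 Y = opnorm ipH1 ipH2 X].

(* Main.v *)
Require Import Defs.
From HB Require Import structures.
From mathcomp Require Import all_boot all_order all_algebra.
From mathcomp Require Import boolp classical_sets reals.
From mathcomp Require Import complex ring lra.
Set Implicit Arguments. Unset Strict Implicit. Unset Printing Implicit Defensive.
Import Order.TTheory GRing.Theory Num.Theory.
Local Open Scope ring_scope.

(* All three parts follow from one lifting theorem, for an isometric lifting [V]
   of [T] and any contractive lifting [W] of [S] with [X T = S X]: take
   [W = Qbar V2], [W = V2 Qbar], and, in the unitary case, [V = V1 Qbar^-1].

   Put [M = |X|] and [B = J2 X P], with [P] the projection of [K1] onto [H1].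
   One looks for [Y = B + F] with [F k] orthogonal to [H2], so that [|Y| <= M]
   means [|F k|^2 <= q k] for the positive semidefinite form
   [q k = M^2 |k|^2 - |B k|^2], and [Y V = W Y] prescribes [F] on the range of
   [V]: [F (V x) = W (B x + F x) - B (V x)].  If [|F|^2 <= q], the right-hand
   side is bounded by [q (V x)], hence extends to [F'] with [|F'|^2 <= q] by
   composing with the [q]-orthogonal projection onto the range of [V].  Iterating
   from [F = 0] yields a strongly convergent sequence, as
   [|F_n k - F_m k|^2 <= q (tau^m k) - q (tau^n k)] for [m <= n], where [tau] is
   [V^-1] after that projection; its limit is the required [F]. *)

(** * Real inequalities for passing to the limit *)

Section RealLemmas.
Context {R : realType}.
Implicit Types a b c t : R.

(** Turns an estimate with error [c * e] into a sharp one; restricting to [e <= 1] lets quadratic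
    errors be absorbed into linear ones. *)
Lemma le_of_small a b c :
  (forall e, 0 < e -> e <= 1 -> a <= b + c * e) -> a <= b.
Proof.
move=> h; rewrite leNgt; apply/negP => ltba.
have c0 : 0 < `|c| + 1 by rewrite ltr_wpDl.
have d0 : 0 < a - b by rewrite subr_gt0.
pose e := Num.min 1 ((a - b) / (2 * (`|c| + 1))).
have e0 : 0 < e by rewrite lt_min ltr01 /= divr_gt0 // mulr_gt0.
have e1 : e <= 1 by rewrite ge_min lexx.
have e2 : e * (`|c| + 1) <= (a - b) / 2.
  have -> : (a - b) / 2 = (a - b) / (2 * (`|c| + 1)) * (`|c| + 1).
    by field; rewrite gt_eqF.
  by rewrite ler_pM2r // ge_min lexx orbT.
have := h e e0 e1; have := ler_norm c => hc.
have : c * e <= e * (`|c| + 1).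
  by rewrite mulrC ler_pM2l //; apply: le_trans hc _; rewrite lerDl.
lra.
Qed.

Lemma discriminant_le a b c : 0 <= b -> 0 <= c ->
  (forall t, 0 <= t ^+ 2 * b - 2 * t * a + c) -> a ^+ 2 <= c * b.
Proof.
move=> b0 c0 h; have [b_eq0|bn0] := eqVneq b 0.
  have [->|an0] := eqVneq a 0; first by rewrite expr0n /= mulr_ge0.
  (* With [b = 0] the polynomial is affine in [t], and this [t] gives it the value -1. *)
  have := h ((c + 1) / (2 * a)); rewrite b_eq0.
  have -> : ((c + 1) / (2 * a)) ^+ 2 * 0 - 2 * ((c + 1) / (2 * a)) * a + c = -1.
    by field.
  lra.
have bp : 0 < b by rewrite lt_def bn0.
have := h (a / b).
have -> : (a / b) ^+ 2 * b - 2 * (a / b) * a + c = (c * b - a ^+ 2) / b by field.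
by rewrite pmulr_lge0 ?invr_gt0 // subr_ge0.
Qed.

(** Carries a quadratic inequality known only at near-projections over to the vector that they
    approximate. *)
Lemma pythagoras_limit a b c : 0 <= a -> 0 <= b -> 0 <= c ->
  (forall e, 0 < e -> exists a' b' c', 
    [/\ 0 <= a', 0 <= b' & 0 <= c'] /\
    [/\ a <= a' + 2 * e, b <= b' + 2 * e, c' <= c + 2 * e
      & a' ^+ 2 + b' ^+ 2 <= c' ^+ 2]) ->
  a ^+ 2 + b ^+ 2 <= c ^+ 2.
Proof.
(* The squares on the left cost [8 * e * c' + 8 * e], [c' ^+ 2] costs [4 * e * c + 4 * e], and
   [e * c' <= e * c + 2 * e]. *)
move=> a0 b0 c0 h; apply: (@le_of_small _ _ (12 * c + 28)) => e e0 e1.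
have [a' [b' [c' [[a'0 b'0 c'0] [aa' bb' cc' h']]]]] := h e e0.
have ac : a' <= c' by nra.
have bc : b' <= c' by nra.
have h1 : a ^+ 2 <= a' ^+ 2 + 4 * e * c' + 4 * e.
  have : a ^+ 2 <= (a' + 2 * e) ^+ 2 by nra.
  have : e * a' <= e * c' by nra.
  have : e * e <= e by nra.
  nra.
have h2 : b ^+ 2 <= b' ^+ 2 + 4 * e * c' + 4 * e.
  have : b ^+ 2 <= (b' + 2 * e) ^+ 2 by nra.
  have : e * b' <= e * c' by nra.
  have : e * e <= e by nra.
  nra.
have h3 : c' ^+ 2 <= c ^+ 2 + 4 * e * c + 4 * e.
  have : c' ^+ 2 <= (c + 2 * e) ^+ 2 by nra.
  have : e * e <= e by nra.
  nra.
have h4 : e * c' <= e * c + 2 * e.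
  have : e * c' <= e * (c + 2 * e) by nra.
  have : e * e <= e by nra.
  nra.
nra.
Qed.

End RealLemmas.

(** * Positive semidefinite forms and their seminorms *)

Section Forms.
Local Open Scope complex_scope.
Context {R : realType}.
Local Notation C := (R[i]).

Definition clinear {U V : lmodType C} (A : U -> V) : Prop :=
  forall (a : C) x y, A (a *: x + y) = a *: A x + A y.

Section Linear.
Context {U V : lmodType C} {A : U -> V} (hA : clinear A).

Lemma clinearD x y : A (x + y) = A x + A y.
Proof. by have := hA 1 x y; rewrite !scale1r. Qed.

Lemma clinear0 : A 0 = 0.
Proof. by have /(canRL (addrK _)) := esym (clinearD 0 0); rewrite addr0 subrr. Qed.

Lemma clinearZ a x : A (a *: x) = a *: A x.
Proof. by have := hA a x 0; rewrite clinear0 !addr0. Qed.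

Lemma clinearN x : A (- x) = - A x.
Proof. by rewrite -scaleN1r clinearZ scaleN1r. Qed.

Lemma clinearB x y : A (x - y) = A x - A y.
Proof. by rewrite clinearD clinearN. Qed.

End Linear.

(* The real part of a positive semidefinite Hermitian form. *)
Definition hform {V : lmodType C} (g : V -> V -> R) : Prop :=
  [/\ forall x y z, g (x + y) z = g x z + g y z,
      forall x y, g x y = g y x,
      forall (r : R) x y, g (r%:C *: x) y = r * g x y,
      forall (a : C) x y, g (a *: x) y = g x (a^* *: y)
    & forall x, 0 <= g x x].

Definition fnorm {V : lmodType C} (g : V -> V -> R) (x : V) : R :=
  Num.sqrt (g x x).

(** The modulus as an element of [R]; the norm of [R[i]] takes its values in [R[i]]. *)
Definition cabs (a : C) : R :=
  Num.sqrt (complex.Re a ^+ 2 + complex.Im a ^+ 2).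

Lemma cabs_ge0 a : 0 <= cabs a. Proof. exact: sqrtr_ge0. Qed.

Lemma conj_mul_cabs (a : C) : a^* * a = (cabs a ^+ 2)%:C.
Proof.
rewrite /cabs sqr_sqrtr ?addr_ge0 ?sqr_ge0 //; case: a => x y /=.
by apply/eqP; rewrite eq_complex /=; apply/andP; split; apply/eqP; ring.
Qed.

Section FormTheory.
Context {V : lmodType C} {g : V -> V -> R} (hg : hform g).

Lemma hformDl x y z : g (x + y) z = g x z + g y z. Proof. by case: hg. Qed.
Lemma hformC x y : g x y = g y x. Proof. by case: hg. Qed.
Lemma hformZl (r : R) x y : g (r%:C *: x) y = r * g x y. Proof. by case: hg. Qed.
Lemma hformJ a x y : g (a *: x) y = g x (a^* *: y). Proof. by case: hg. Qed.
Lemma hform_ge0 x : 0 <= g x x. Proof. by case: hg. Qed.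

Lemma hformDr x y z : g x (y + z) = g x y + g x z.
Proof. by rewrite hformC hformDl !(hformC x). Qed.

Lemma hformZr (r : R) x y : g x (r%:C *: y) = r * g x y.
Proof. by rewrite hformC hformZl hformC. Qed.

Lemma hformNl x y : g (- x) y = - g x y.
Proof.
have -> : - x = (-1 : R)%:C *: x by rewrite rmorphN1 scaleN1r.
by rewrite hformZl mulN1r.
Qed.

Lemma hformNr x y : g x (- y) = - g x y.
Proof. by rewrite hformC hformNl hformC. Qed.

Lemma hformBl x y z : g (x - y) z = g x z - g y z.
Proof. by rewrite hformDl hformNl. Qed.

Lemma hform0l y : g 0 y = 0.
Proof. by rewrite -(subrr 0) hformBl subrr. Qed.

Lemma hformBr x y z : g x (y - z) = g x y - g x z.
Proof. by rewrite hformDr hformNr. Qed.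

Lemma fnorm_ge0 x : 0 <= fnorm g x. Proof. exact: sqrtr_ge0. Qed.

Lemma fnorm_sqr x : fnorm g x ^+ 2 = g x x.
Proof. by rewrite sqr_sqrtr // hform_ge0. Qed.

Lemma fnorm_le x c : 0 <= c -> g x x <= c ^+ 2 -> fnorm g x <= c.
Proof. by move=> c0 h; rewrite -(ger0_norm c0) -sqrtr_sqr ler_wsqrtr. Qed.

(** Discriminant of the nonnegative polynomial [g (x - t y) (x - t y)] in the real variable [t];
    degenerate forms are covered. *)
Lemma hform_schwarz x y : `|g x y| <= fnorm g x * fnorm g y.
Proof.
rewrite -ler_sqr ?nnegrE ?mulr_ge0 ?fnorm_ge0 // exprMn !fnorm_sqr.
rewrite real_normK ?num_real //; apply: discriminant_le; rewrite ?hform_ge0 // => t.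
have := hform_ge0 (x - t%:C *: y).
by rewrite hformBl !hformBr !hformZl !hformZr (hformC y x); lra.
Qed.

Lemma fnormD x y : fnorm g (x + y) <= fnorm g x + fnorm g y.
Proof.
apply: fnorm_le; first by rewrite addr_ge0 ?fnorm_ge0.
rewrite hformDl !hformDr (hformC y x) sqrrD !fnorm_sqr.
have := le_trans (ler_norm _) (hform_schwarz x y); lra.
Qed.

Lemma fnormN x : fnorm g (- x) = fnorm g x.
Proof. by rewrite /fnorm hformNl hformNr opprK. Qed.

Lemma fnormB x y : fnorm g (x - y) <= fnorm g x + fnorm g y.
Proof. by rewrite -(fnormN y); exact: fnormD. Qed.

Lemma fnorm_sym x y : fnorm g (x - y) = fnorm g (y - x).
Proof. by rewrite -fnormN opprB. Qed.

Lemma fnorm_triangle z x y : fnorm g (x - y) <= fnorm g (x - z) + fnorm g (z - y).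
Proof. by rewrite -{1}(subrK z x) -addrA; exact: fnormD. Qed.

Lemma fnorm_lip x y : `|fnorm g x - fnorm g y| <= fnorm g (x - y).
Proof.
have := fnormD (x - y) y; rewrite subrK => h1.
have := fnormD (y - x) x; rewrite subrK fnorm_sym => h2.
rewrite ler_norml; lra.
Qed.

Lemma fnormZ a x : fnorm g (a *: x) = cabs a * fnorm g x.
Proof.
rewrite /fnorm hformJ scalerA conj_mul_cabs hformZr sqrtrM ?sqr_ge0 //.
by rewrite sqrtr_sqr ger0_norm ?cabs_ge0.
Qed.

Lemma fnorm0 : fnorm g 0 = 0.
Proof. by rewrite /fnorm hform0l sqrtr0. Qed.

End FormTheory.
End Forms.

(** * Approximate orthogonal projections for a degenerate form *)

Section NearProjection.
Local Open Scope complex_scope.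
Context {R : realType} {U K : lmodType R[i]}.
Context {q : K -> K -> R} (hq : hform q) {j : U -> K} (hj : clinear j).

(* [j x] is, up to [e], the [q]-orthogonal projection of [k] onto the range
   of [j], which need not exist as [q] may be degenerate and not complete. *)
Definition near_proj (k : K) (x : U) (e : R) : Prop :=
  forall y, `|q (k - j x) (j y)| <= e * fnorm q (j y).

Lemma near_proj_range x : near_proj (j x) x 0.
Proof.
by move=> y; rewrite subrr mul0r (hform0l hq) normr0.
Qed.

Lemma near_proj_linear a k k' x x' e e' : near_proj k x e -> near_proj k' x' e' ->
  near_proj (a *: k + k') (a *: x + x') (cabs a * e + e').
Proof.
move=> h h' y; rewrite hj opprD addrACA -scalerBr (hformDl hq) (hformJ hq).
rewrite -(clinearZ hj) mulrDl (le_trans (ler_normD _ _)) // lerD //.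
apply: le_trans (h _) _; rewrite (clinearZ hj) (fnormZ hq) mulrCA mulrA.
by rewrite /cabs; case: (a) => u v /=; rewrite sqrrN.
Qed.

Lemma near_projB k k' x x' e e' : near_proj k x e -> near_proj k' x' e' ->
  near_proj (k - k') (x - x') (e + e').
Proof.
move=> h h'; have := near_proj_linear (-1) h' h; rewrite !scaleN1r.
rewrite (addrC (- k')) (addrC (- x')) (addrC e).
by rewrite /cabs /= oppr0 expr0n /= addr0 sqrrN expr1n sqrtr1 mul1r.
Qed.

(** Schwarz applied to [q (j x) (j x) = q k (j x) - q (k - j x) (j x)], divided by the norm of
    [j x]. *)
Lemma near_proj_norm k x e : 0 <= e -> near_proj k x e ->
  fnorm q (j x) <= fnorm q k + e.
Proof.
move=> e0 h; have [->|n0] := eqVneq (fnorm q (j x)) 0.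
  by rewrite addr_ge0 ?fnorm_ge0.
have np : 0 < fnorm q (j x) by rewrite lt_def n0 fnorm_ge0.
rewrite -(ler_pM2r np) -expr2 (fnorm_sqr hq).
have -> : q (j x) (j x) = q k (j x) - q (k - j x) (j x) by rewrite (hformBl hq); ring.
have := h x; rewrite ler_norml => /andP[h1 _].
have := le_trans (ler_norm _) (hform_schwarz hq k (j x)).
rewrite mulrDl; lra.
Qed.

(** Take [x] whose squared distance to [k] exceeds the infimum by less than [e ^+ 2]. Moving [x] by
    [t y] cannot go below the infimum, and the discriminant in [t] gives the bound. *)
Lemma near_proj_exists k (e : R) : 0 < e -> exists x, near_proj k x e.
Proof.
move=> e0; pose S := [set q (k - j x) (k - j x) | x in setT]%classic.
have S0 : has_inf S.
  split; first by exists (q (k - j 0) (k - j 0)); exists 0.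
  by exists 0 => _ [x _ <-]; exact: hform_ge0.
have [_ [x _ <-] hx] := inf_adherent (exprn_gt0 2 e0) S0.
exists x => y; rewrite -ler_sqr ?nnegrE ?mulr_ge0 ?fnorm_ge0 ?(ltW e0) //.
rewrite exprMn (fnorm_sqr hq) real_normK ?num_real //.
apply: discriminant_le; rewrite ?hform_ge0 ?sqr_ge0 // => t.
have : inf S <= q (k - j (t%:C *: y + x)) (k - j (t%:C *: y + x)).
  by apply: ge_inf; [case: S0|exists (t%:C *: y + x)].
have -> : k - j (t%:C *: y + x) = (k - j x) - t%:C *: j y.
  by rewrite hj opprD addrCA addrC.
rewrite (hformBl hq _ (t%:C *: j y)) !(hformBr hq _ _ (t%:C *: j y)).
rewrite !(hformZl hq, hformZr hq) (hformC hq (j y) (k - j x)).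
move: hx; lra.
Qed.

End NearProjection.

(** * Completeness and definiteness *)

Section Limits.
Context {R : realType} {Z : lmodType R[i]}.

(** Shaped so that [hcomplete ip] is convertible to it when [g] is the real part of [ip]. *)
Definition fcomplete (g : Z -> Z -> R) : Prop :=
  forall u : nat -> Z,
    (forall e : R, 0 < e -> exists N, forall m n, (N <= m)%N -> (N <= n)%N ->
        fnorm g (u m - u n) < e) ->
    exists l : Z, forall e : R, 0 < e -> exists N, forall n, (N <= n)%N ->
        fnorm g (u n - l) < e.

Definition fdefinite (g : Z -> Z -> R) : Prop := forall z, g z z = 0 -> z = 0.

Lemma fnorm_eq (g : Z -> Z -> R) (hg : hform g) (dg : fdefinite g) z z' c :
  (forall e : R, 0 < e -> e <= 1 -> fnorm g (z - z') <= c * e) -> z = z'.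
Proof.
move=> h; apply/eqP; rewrite -subr_eq0; apply/eqP/dg.
rewrite -(fnorm_sqr hg).
have /(conj (fnorm_ge0 (g := g) (z - z')))/andP : fnorm g (z - z') <= 0.
  by apply: (@le_of_small _ _ _ c) => e e0 e1; rewrite add0r h.
by rewrite -eq_le => /eqP <-; rewrite expr0n.
Qed.

Lemma invS_small (e : R) : 0 < e ->
  exists N, forall n, (N <= n)%N -> n.+1%:R^-1 < e.
Proof.
move=> e0; exists (Num.bound e^-1) => n hn.
rewrite invf_plt ?posrE ?ltr0Sn //.
apply: lt_trans (archi_boundP _) _; first by rewrite invr_ge0 ltW.
by rewrite ltr_nat ltnS.
Qed.

End Limits.

(** * Extension by continuity from the range of an operator *)

Section Extension.
Context {R : realType} {U K Z : lmodType R[i]}.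
Context {q : K -> K -> R} (hq : hform q) {j : U -> K} (hj : clinear j).
Context {g : Z -> Z -> R} (hg : hform g) (cg : fcomplete g) (dg : fdefinite g).

Local Notation near_proj := (near_proj (q := q) (j := j)).

(** [x - x'] is a near-projection of [k - k = 0]. *)
Lemma near_proj_close k x x' (e e' : R) : 0 <= e -> 0 <= e' ->
  near_proj k x e -> near_proj k x' e' -> fnorm q (j (x - x')) <= e + e'.
Proof.
move=> e0 e'0 h h'.
have := near_proj_norm hq (addr_ge0 e0 e'0) (near_projB hq hj h h').
by rewrite subrr (fnorm0 hq) add0r.
Qed.

(* The extension of [c \o j^-1] from the range of [j] by [q]-continuity along
   the [q]-orthogonal projection. *)
Definition ext (c : U -> Z) (k : K) : Z :=
  xget 0 [set z | forall x e, 0 <= e -> near_proj k x e ->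
                    fnorm g (c x - z) <= e]%classic.

Section ExtTheory.
Context {c : U -> Z}.
Hypothesis lipc : forall x y, fnorm g (c x - c y) <= fnorm q (j (x - y)).

(** Near-projections of [k] with errors tending to 0 have Cauchy images under [c]; the limit
    satisfies the condition by which [ext] selects its value. *)
Lemma extP k x (e : R) : 0 <= e -> near_proj k x e -> fnorm g (c x - ext c k) <= e.
Proof.
suff [z hz] : exists z, forall x e, 0 <= e -> near_proj k x e ->
    fnorm g (c x - z) <= e.
  move: x e; rewrite /ext.
  exact: (@xgetPex _ 0 [set z | forall x e, 0 <= e -> near_proj k x e ->
                    fnorm g (c x - z) <= e]%classic (ex_intro _ z hz)).
have h n : exists x, near_proj k x n.+1%:R^-1.
  by apply: near_proj_exists; rewrite // invr_gt0 ltr0Sn.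
pose s n := projT1 (cid (h n)).
have hs n : near_proj k (s n) n.+1%:R^-1 by exact: projT2 (cid (h n)).
have p n : 0 <= (n.+1%:R^-1 : R) by rewrite invr_ge0 ler0n.
have [|l hl] := cg (u := fun n => c (s n)).
  move=> e' e'0; have [N hN] : exists N, forall n, (N <= n)%N -> n.+1%:R^-1 < e' / 2.
    by apply: invS_small; rewrite divr_gt0.
  exists N => m n /hN hm /hN hn; apply: le_lt_trans (lipc _ _) _.
  apply: le_lt_trans (near_proj_close (p m) (p n) (hs m) (hs n)) _.
  by rewrite (splitr e') ltrD.
exists l => {}x {}e e0 hx; apply: (@le_of_small _ _ _ 2) => d d0 _.
have [N hN] := hl _ d0; have [N' hN'] := invS_small d0.
pose n := maxn N N'.
have h1 := hN n (leq_maxl _ _); have h2 := hN' n (leq_maxr _ _).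
have h3 := le_trans (near_proj_close e0 (p n) hx (hs n)) (lerD (lexx e) (ltW h2)).
have h4 := lipc x (s n); have := fnorm_triangle hg (c (s n)) (c x) l; lra.
Qed.

Lemma ext_range x : ext c (j x) = c x.
Proof.
apply: (fnorm_eq hg dg (c := 0)) => e _ _; rewrite mul0r (fnorm_sym hg).
exact/extP/near_proj_range.
Qed.

Lemma ext_linear : clinear c -> clinear (ext c).
Proof.
(* Half of the constant comes from the near-projection of [a *: k + k'], half from those of [k] and
   [k']. *)
move=> lc a k k'; apply: (fnorm_eq hg dg (c := 2 * (cabs a + 1))) => e e0 _.
have [x hx] := near_proj_exists hq hj k e0.
have [x' hx'] := near_proj_exists hq hj k' e0.
have h := extP (ltW e0) hx; have h' := extP (ltW e0) hx'.
have ce : 0 <= cabs a * e + e by rewrite addr_ge0 ?mulr_ge0 ?cabs_ge0 ?ltW.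
have h'' := extP ce (near_proj_linear hq hj a hx hx').
rewrite (fnorm_sym hg).
apply: le_trans (fnorm_triangle hg (c (a *: x + x')) _ _) _.
rewrite (fnorm_sym hg _ (c _)).
have -> : c (a *: x + x') - (a *: ext c k + ext c k') =
    a *: (c x - ext c k) + (c x' - ext c k').
  by rewrite lc scalerBr opprD addrACA.
have := fnormD hg (a *: (c x - ext c k)) (c x' - ext c k').
rewrite (fnormZ hg); have := ler_wpM2l (cabs_ge0 a) h; lra.
Qed.

End ExtTheory.

(** Counterpart of [ext] for real functions that need not be linear: the supremum of the lower
    bounds that near-projections give for the limit value. *)
Definition sext (s : U -> R) (k : K) : R :=
  sup [set r | exists x e, [/\ 0 <= e, near_proj k x e & r = s x - e]]%classic.

Lemma sextP (s : U -> R) :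
  (forall x y, `|s x - s y| <= fnorm q (j (x - y))) ->
  forall k x e, 0 <= e -> near_proj k x e -> `|s x - sext s k| <= e.
Proof.
move=> lips k x e e0 hx; rewrite /sext; set S := [set r | _]%classic.
(* Each upper bound dominates each lower bound, since two near-projections of [k] differ by at most
   the sum of their errors. *)
have ub y d : 0 <= d -> near_proj k y d -> ubound S (s y + d).
  move=> d0 hy _ [z [b [b0 hz ->]]].
  have := near_proj_close b0 d0 hz hy; have := lips z y.
  rewrite ler_norml => /andP[_]; lra.
have S0 : nonempty S by exists (s x - e), x, e.
have h1 : sup S <= s x + e by apply: sup_le_ub => //; exact: ub.
have h2 : s x - e <= sup S.
  by apply: ub_le_sup; [exists (s x + e); exact: ub|exists x, e].
rewrite ler_norml; lra.
Qed.

End Extension.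

(** * The lifting theorem, stated for forms *)

Section Lifting.
Context {R : realType} {K1 K2 : lmodType R[i]}.
Context {g1 : K1 -> K1 -> R} (hg1 : hform g1).
Context {g2 : K2 -> K2 -> R} (hg2 : hform g2).
Hypotheses (cg2 : fcomplete g2) (dg2 : fdefinite g2).
Context {V : K1 -> K1} {W : K2 -> K2} {B : K1 -> K2} {M : R} {L : K2 -> Prop}.
Hypotheses (hV : clinear V) (isoV : forall x, g1 (V x) (V x) = g1 x x).
Hypotheses (hW : clinear W) (contrW : forall z, g2 (W z) (W z) <= g2 z z).
Hypotheses (hB : clinear B) (LB : forall x, L (B x)).
Hypotheses (boundB : forall x, g2 (B x) (B x) <= M ^+ 2 * g1 x x).

(** [L] plays the part of the subspace [H2]. Only real parts vanish here, which for a complex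
    subspace is full orthogonality. *)
Let orth (z : K2) : Prop := forall y, L y -> g2 z y = 0.

Hypotheses (orthW : forall z, orth z -> orth (W z)).
Hypotheses (interB : forall x, orth (W (B x) - B (V x))).
Hypotheses (decrB : forall x, g2 (B (V x)) (B (V x)) <= g2 (B x) (B x)).

Let q (x y : K1) : R := M ^+ 2 * g1 x y - g2 (B x) (B y).

Lemma defect_hform : hform q.
Proof.
rewrite /q; split=> [x y z|x y|r x y|a x y|x].
- by rewrite (clinearD hB) (hformDl hg1) (hformDl hg2); ring.
- by rewrite (hformC hg1) (hformC hg2).
- by rewrite (clinearZ hB) (hformZl hg1) (hformZl hg2); ring.
- by rewrite !(clinearZ hB) (hformJ hg1) (hformJ hg2).
- by rewrite subr_ge0.
Qed.
Let hq := defect_hform.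

(** [V] preserves [g1], while [B (V x)] is no longer than [B x]; so [V^-1] contracts the
    [q]-norm. *)
Lemma defect_norm_incr x : fnorm q x <= fnorm q (V x).
Proof. by rewrite ler_wsqrtr // /q isoV lerB. Qed.

Lemma orthD z z' : orth z -> orth z' -> orth (z + z').
Proof. by move=> h h' y Ly; rewrite (hformDl hg2) h // h' // addr0. Qed.

Definition next_corner (F : K1 -> K2) (x : K1) : K2 := W (B x + F x) - B (V x).

Definition admissible (F : K1 -> K2) : Prop :=
  [/\ clinear F, forall k, orth (F k) & forall k, fnorm g2 (F k) <= fnorm q k].

Section NextCorner.
Context {F : K1 -> K2} (hF : admissible F).

Lemma next_corner_linear : clinear (next_corner F).
Proof.
case: hF => lF _ _ a x y; rewrite /next_corner lF hV !hB addrACA -scalerDr hW.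
by rewrite opprD addrACA -scalerBr.
Qed.

Lemma next_corner_orth x : orth (next_corner F x).
Proof.
case: hF => _ oF _; rewrite /next_corner (clinearD hW) addrAC.
by apply: orthD; [exact: interB|exact/orthW/oF].
Qed.

(** Pythagoras on both sides of the contractivity of [W] at [B x + F x], whose image is [B (V x)]
    plus the orthogonal vector [next_corner F x]; [q (V x) (V x) - q x x] is the drop from [|B x|^2]
    to [|B (V x)|^2]. *)
Lemma next_corner_sqr x :
  g2 (next_corner F x) (next_corner F x) <=
  q (V x) (V x) - q x x + g2 (F x) (F x).
Proof.
have hc := next_corner_orth x; case: hF => _ oF _.
have := contrW (B x + F x).
rewrite -(subrK (B (V x)) (W _)) -/(next_corner F x).
move: (next_corner F x) hc => c hc.
rewrite !(hformDl hg2) !(hformDr hg2) (hformC hg2 _ c) (hc _ (LB _)).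
rewrite (hformC hg2 (B x) (F x)) (oF _ _ (LB _)) /q isoV; lra.
Qed.

(** The Lipschitz hypothesis of [ext]: admissibility of [F] makes [|F|^2 - q] nonpositive in the
    preceding estimate. *)
Lemma next_corner_lip x y :
  fnorm g2 (next_corner F x - next_corner F y) <= fnorm q (V (x - y)).
Proof.
rewrite -(clinearB next_corner_linear) ler_wsqrtr //.
apply: le_trans (next_corner_sqr _) _; case: hF => _ _ /(_ (x - y)).
rewrite -ler_sqr ?nnegrE ?fnorm_ge0 // (fnorm_sqr hg2) (fnorm_sqr hq); lra.
Qed.

End NextCorner.

Fixpoint corner (n : nat) : K1 -> K2 :=
  if n is n'.+1 then ext (q := q) (j := V) (g := g2) (next_corner (corner n'))
  else fun=> 0.

(* In the [q]-completion, [defect_iter n k] is the [q]-norm of [tau ^ n k],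
   where [tau] is [V^-1] composed with the projection onto the range of [V]. *)
Fixpoint defect_iter (n : nat) : K1 -> R :=
  if n is n'.+1 then sext (q := q) (j := V) (defect_iter n')
  else fnorm q.

Lemma defect_iter_lip n x y :
  `|defect_iter n x - defect_iter n y| <= fnorm q (x - y).
Proof.
elim: n x y => [|n IH] x y; first exact: fnorm_lip.
have lipV z z' := le_trans (IH z z') (defect_norm_incr _).
(* Two errors [e] come from [sext] at [x] and [y], two more from the norm of the near-projection of
   [x - y]. *)
apply: (@le_of_small _ _ _ 4) => e e0 _.
have [u hu] := near_proj_exists hq hV x e0.
have [v hv] := near_proj_exists hq hV y e0.
have := sextP hq hV lipV (ltW e0) hu; have := sextP hq hV lipV (ltW e0) hv.
have := near_proj_norm hq (addr_ge0 (ltW e0) (ltW e0)) (near_projB hq hV hu hv).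
move=> /(le_trans (lipV u v)).
rewrite /= !ler_norml => /andP[h1 h2] /andP[h3 h4] /andP[h5 h6]; lra.
Qed.

Lemma defect_iter_lipV n x y :
  `|defect_iter n x - defect_iter n y| <= fnorm q (V (x - y)).
Proof. exact: le_trans (defect_iter_lip n x y) (defect_norm_incr _). Qed.

Lemma defect_iter_ge0 n x : 0 <= defect_iter n x.
Proof.
elim: n x => [|n IH] x; first exact: fnorm_ge0.
apply: (@le_of_small _ _ _ 1) => e e0 _.
have [u hu] := near_proj_exists hq hV x e0.
have := sextP hq hV (defect_iter_lipV n) (ltW e0) hu.
rewrite ler_norml; have := IH u; rewrite /=; lra.
Qed.

(** The energy estimate is what the induction carries. At a near-projection [x], adding
    [next_corner_sqr] and the estimate for [n] cancels [q x x] and the norm of [corner n x], leaving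
    [q (V x) (V x)] as bound. *)
Lemma corner_admissible n : admissible (corner n) /\
  forall k, fnorm g2 (corner n k) ^+ 2 + defect_iter n k ^+ 2 <= fnorm q k ^+ 2.
Proof.
elim: n => [|n [IH IHn]].
  split; last by move=> k; rewrite /= (fnorm0 hg2) expr0n add0r.
  split=> [a x y|k y _|k]; first by rewrite scaler0 addr0.
    exact: hform0l hg2 _.
  by rewrite (fnorm0 hg2) fnorm_ge0.
have est k : fnorm g2 (corner n.+1 k) ^+ 2 + defect_iter n.+1 k ^+ 2 <=
    fnorm q k ^+ 2.
  apply: pythagoras_limit; rewrite ?fnorm_ge0 ?defect_iter_ge0 // => e e0.
  have [x hx] := near_proj_exists hq hV k e0.
  exists (fnorm g2 (next_corner (corner n) x)), (defect_iter n x), (fnorm q (V x)).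
  split; first by split; rewrite ?fnorm_ge0 ?defect_iter_ge0.
  have h1 := extP hq hV hg2 cg2 (next_corner_lip IH) (ltW e0) hx.
  have := sextP hq hV (defect_iter_lipV n) (ltW e0) hx.
  rewrite ler_norml => /andP[h2 h3].
  have h4 := near_proj_norm hq (ltW e0) hx.
  split; [|rewrite /=; lra|lra|].
    have := fnormB hg2 (next_corner (corner n) x)
      (next_corner (corner n) x - corner n.+1 k).
    rewrite subKr /=; lra.
  have := next_corner_sqr IH x; have := IHn x.
  rewrite !(fnorm_sqr hg2) !(fnorm_sqr hq); lra.
split=> //; split.
- exact: (ext_linear hq hV hg2 cg2 dg2 (next_corner_lip IH) (next_corner_linear IH)).
(* [corner n.+1 k] lies within [e] of an orthogonal vector, for every [e]. *)
- move=> k y Ly; apply/eqP; rewrite -normr_eq0 eq_le normr_ge0 andbT.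
  apply: (@le_of_small _ _ _ (fnorm g2 y)) => e e0 _.
  have [x hx] := near_proj_exists hq hV k e0.
  have h1 := extP hq hV hg2 cg2 (next_corner_lip IH) (ltW e0) hx.
  have := hform_schwarz hg2 (next_corner (corner n) x - corner n.+1 k) y.
  rewrite (hformBl hg2) (next_corner_orth IH) // sub0r normrN add0r => h2.
  by apply: le_trans h2 _; rewrite mulrC ler_wpM2l ?fnorm_ge0.
- move=> k; rewrite -ler_sqr ?nnegrE ?fnorm_ge0 //.
  by have := est k; have := sqr_ge0 (defect_iter n.+1 k); lra.
Qed.

Lemma corner_range n x : corner n.+1 (V x) = next_corner (corner n) x.
Proof.
have [IH _] := corner_admissible n.
exact: (ext_range hq hV hg2 cg2 dg2 (next_corner_lip IH)).
Qed.

(** Induction on [m], starting from the energy estimate since [corner 0] is zero. In the step the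
    terms in [B] cancel, so successive differences are related by the contraction [W] and the
    extension. *)
Lemma corner_cauchy m n k :
  fnorm g2 (corner (m + n) k - corner m k) ^+ 2 + defect_iter (m + n) k ^+ 2 <=
  defect_iter m k ^+ 2.
Proof.
elim: m k => [|m IH] k.
  by rewrite subr0; have [_] := corner_admissible n.
rewrite addSn.
apply: pythagoras_limit; rewrite ?fnorm_ge0 ?defect_iter_ge0 // => e e0.
have [x hx] := near_proj_exists hq hV k e0.
pose c i := next_corner (corner i).
have a i := (corner_admissible i).1.
exists (fnorm g2 (c (m + n)%N x - c m x)), (defect_iter (m + n) x), (defect_iter m x).
split; first by split; rewrite ?fnorm_ge0 ?defect_iter_ge0.
have h1 i := extP hq hV hg2 cg2 (next_corner_lip (a i)) (ltW e0) hx.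
have := sextP hq hV (defect_iter_lipV m) (ltW e0) hx.
rewrite ler_norml => /andP[h2 h3].
have := sextP hq hV (defect_iter_lipV (m + n)) (ltW e0) hx.
rewrite ler_norml => /andP[h4 h5].
split; [|rewrite /=; lra|rewrite /=; lra|].
  have := h1 m; have := h1 (m + n)%N; rewrite (fnorm_sym hg2) => h6 h7.
  have := fnorm_triangle hg2 (c m x) (corner (m + n).+1 k) (corner m.+1 k).
  have := fnorm_triangle hg2 (c (m + n)%N x) (corner (m + n).+1 k) (c m x).
  rewrite /= /c; lra.
apply: le_trans (IH x); rewrite lerD2r !(fnorm_sqr hg2).
have -> : c (m + n)%N x - c m x = W (corner (m + n) x - corner m x).
  rewrite /c /next_corner opprD opprK addrACA addNr addr0 -(clinearB hW).
  by rewrite opprD addrACA subrr add0r.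
exact: contrW.
Qed.

Lemma corner_cvg : exists F : K1 -> K2, forall k e, 0 < e ->
  exists N, forall n, (N <= n)%N -> fnorm g2 (corner n k - F k) < e.
Proof.
suff h k : exists l, forall e, 0 < e ->
    exists N, forall n, (N <= n)%N -> fnorm g2 (corner n k - l) < e.
  by exists (fun k => projT1 (cid (h k))) => k; exact: projT2 (cid (h k)).
apply: cg2 => e e0.
pose S := [set defect_iter n k ^+ 2 | n in setT]%classic.
have S0 : has_inf S.
  split; first by exists (defect_iter 0 k ^+ 2); exists 0%N.
  by exists 0 => _ [n _ <-]; exact: sqr_ge0.
have e2 : 0 < e / 2 by rewrite divr_gt0.
(* Past this [N] the squares of [defect_iter] can drop by less than [(e / 2) ^+ 2], which bounds the
   squared distance to [corner N k]. *)
have [_ [N _ <-] hN] := inf_adherent (exprn_gt0 2 e2) S0.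
have h n : (N <= n)%N -> fnorm g2 (corner n k - corner N k) < e / 2.
  move=> /subnKC <-; rewrite -ltr_sqr ?nnegrE ?fnorm_ge0 ?(ltW e2) //.
  have := corner_cauchy N (n - N) k.
  have : inf S <= defect_iter (N + (n - N)) k ^+ 2.
    by apply: ge_inf; [case: S0|exists (N + (n - N))%N].
  move: hN; lra.
exists N => m n /h hm /h; rewrite (fnorm_sym hg2) => hn.
have := fnorm_triangle hg2 (corner N k) (corner m k) (corner n k); lra.
Qed.

Theorem isometry_intertwining_lifting : exists Y : K1 -> K2,
  [/\ clinear Y, forall k, orth (Y k - B k),
      forall k, g2 (Y k) (Y k) <= M ^+ 2 * g1 k k
    & forall k, Y (V k) = W (Y k)].
Proof.
have [F cF] := corner_cvg.
have adm n := (corner_admissible n).1.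
have close k e : 0 < e -> exists N, forall n, (N <= n)%N ->
    fnorm g2 (F k - corner n k) <= e.
  move=> /(cF k)[N hN]; exists N => n /hN; rewrite (fnorm_sym hg2); exact: ltW.
have linF : clinear F.
  move=> a x y; apply: (fnorm_eq hg2 dg2 (c := cabs a + 2)) => e e0 _.
  have [N1 h1] := close (a *: x + y) e e0.
  have [N2 h2] := close x e e0; have [N3 h3] := close y e e0.
  pose n := maxn N1 (maxn N2 N3).
  have {}h1 := h1 n (leq_maxl _ _).
  have {}h2 : fnorm g2 (F x - corner n x) <= e.
    by apply: h2; rewrite /n !leq_max leqnn orbT.
  have {}h3 : fnorm g2 (F y - corner n y) <= e.
    by apply: h3; rewrite /n !leq_max leqnn !orbT.
  apply: le_trans (fnorm_triangle hg2 (corner n (a *: x + y)) _ _) _.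
  have [lc _ _] := adm n.
  have -> : corner n (a *: x + y) - (a *: F x + F y) =
      - (a *: (F x - corner n x) + (F y - corner n y)).
    by rewrite lc scalerBr addrACA -opprD opprB.
  rewrite (fnormN hg2).
  have := fnormD hg2 (a *: (F x - corner n x)) (F y - corner n y).
  rewrite (fnormZ hg2); have := ler_wpM2l (cabs_ge0 a) h2; lra.
have orthF k : orth (F k).
  move=> y Ly; apply/eqP; rewrite -normr_eq0 eq_le normr_ge0 andbT.
  apply: (@le_of_small _ _ _ (fnorm g2 y)) => e e0 _.
  have [N /(_ N (leqnn _)) hN] := close k e e0; have [_ oc _] := adm N.
  have := hform_schwarz hg2 (F k - corner N k) y.
  rewrite (hformBl hg2) oc // subr0 add0r => h.
  by apply: le_trans h _; rewrite mulrC ler_wpM2l ?fnorm_ge0.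
have boundF k : fnorm g2 (F k) <= fnorm q k.
  apply: (@le_of_small _ _ _ 1) => e e0 _.
  have [N /(_ N (leqnn _)) hN] := close k e e0; have [_ _ /(_ k) bc] := adm N.
  have := fnormD hg2 (F k - corner N k) (corner N k); rewrite subrK; lra.
exists (fun k => B k + F k); split.
- by move=> a x y; rewrite hB linF addrACA -scalerDr.
- by move=> k; rewrite addrAC subrr add0r; exact: orthF.
(* [B k] and [F k] are orthogonal, so the squared norms add up to at most
   [|B k|^2 + q k k = M ^+ 2 * g1 k k]. *)
- move=> k; have := boundF k.
  rewrite -ler_sqr ?nnegrE ?fnorm_ge0 // (fnorm_sqr hg2) (fnorm_sqr hq) /q.
  rewrite (hformDl hg2) !(hformDr hg2) (hformC hg2 (B k) (F k))
    (orthF _ _ (LB _)); lra.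
- move=> k; apply: (fnorm_eq hg2 dg2 (c := 2)) => e e0 _.
  have [N1 h1] := close (V k) e e0; have [N2 h2] := close k e e0.
  pose n := maxn N1 N2.
  (* The recursion links index [n.+1] at [V k] with index [n] at [k]. *)
  have {}h1 : fnorm g2 (F (V k) - corner n.+1 (V k)) <= e.
    by apply: h1; rewrite leqW // leq_maxl.
  have {}h2 := h2 n (leq_maxr _ _).
  have h3 : fnorm g2 (W (F k - corner n k)) <= e.
    by apply: le_trans h2; rewrite ler_wsqrtr.
  have -> : B (V k) + F (V k) - W (B k + F k) =
      (F (V k) - corner n.+1 (V k)) - W (F k - corner n k).
    rewrite corner_range /next_corner (clinearB hW) !(clinearD hW).
    by rewrite !opprB !opprD !addrA subrK (addrC (F _)).
  have := fnormB hg2 (F (V k) - corner n.+1 (V k)) (W (F k - corner n k)); lra.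
Qed.

End Lifting.

(** * Inner products and their real parts *)

Section InnerProduct.
Local Open Scope complex_scope.
Context {R : realType} {V : lmodType R[i]}.

Definition rip (ip : V -> V -> R[i]) (x y : V) : R := complex.Re (ip x y).

Context {ip : V -> V -> R[i]} (hip : is_inner_product ip).

Lemma ipDl x y z : ip (x + y) z = ip x z + ip y z.
Proof. by case: hip => h _ _ _; have := h 1 x y z; rewrite scale1r mul1r. Qed.

Lemma ip0l z : ip 0 z = 0.
Proof. by apply: (addrI (ip 0 z)); rewrite -ipDl !addr0. Qed.

Lemma ipZl a x z : ip (a *: x) z = a * ip x z.
Proof. by case: hip => h _ _ _; have := h a x 0 z; rewrite ip0l !addr0. Qed.

Lemma ipC x y : ip y x = (ip x y)^*.
Proof. by case: hip. Qed.

Lemma ipZr a x z : ip x (a *: z) = a^* * ip x z.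
Proof. by rewrite ipC ipZl rmorphM /= -ipC. Qed.

Lemma ipBl x y z : ip (x - y) z = ip x z - ip y z.
Proof. by rewrite ipDl -scaleN1r ipZl mulN1r. Qed.

Lemma rip_hform : hform (rip ip).
Proof.
rewrite /rip; split=> [x y z|x y|r x y|a x y|x].
- by rewrite ipDl; case: (ip x z) (ip y z) => [? ?] [? ?].
- by rewrite (ipC y); case: (ip y x).
- by rewrite ipZl; case: (ip x y) => a b /=; rewrite mul0r subr0.
- by rewrite ipZl ipZr conjCK.
- by case: hip => _ _ /(_ x) + _; rewrite lecE => /andP[].
Qed.

Lemma rip_definite : fdefinite (rip ip).
Proof.
move=> z; rewrite /rip => h; case: hip => _ _ /(_ z) + /(_ z) def.
rewrite lecE => /andP[/eqP im0 _]; apply: def.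
by apply/eqP; rewrite eq_complex h im0 /= !eqxx.
Qed.

(** The real part of [ip x ('i *: y)] is the imaginary part of [ip x y]. *)
Lemma ip_eq0 x y : rip ip x y = 0 -> rip ip x ('i *: y) = 0 -> ip x y = 0.
Proof.
rewrite /rip ipZr; case: (ip x y) => a b /= -> h.
by apply/eqP; rewrite eq_complex /= eqxx /=; apply/eqP; move: h; lra.
Qed.

End InnerProduct.

(** * The operator norm as a supremum *)

Section OperatorNorm.
Context {R : realType} {V W : lmodType R[i]}.
Context {ipV : V -> V -> R[i]} (hV : is_inner_product ipV).
Context {ipW : W -> W -> R[i]} (hW : is_inner_product ipW).

Lemma opnorm_le (A : V -> W) (M : R) : 0 <= M ->
  (forall x, hnorm ipW (A x) <= M * hnorm ipV x) -> opnorm ipV ipW A <= M.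
Proof.
move=> M0 h; apply: sup_le_ub.
  by exists (hnorm ipW (A 0)), 0 => //=; rewrite [hnorm _ _](fnorm0 (rip_hform hV)).
move=> _ [x /= x1 <-]; apply: le_trans (h x) _.
by rewrite -[leRHS]mulr1 ler_wpM2l.
Qed.

Lemma opnorm_ge (A : V -> W) x : hbounded_op ipV ipW A -> hnorm ipV x <= 1 ->
  hnorm ipW (A x) <= opnorm ipV ipW A.
Proof.
move=> [lA [M hM]] x1; apply: ub_le_sup; last by exists x.
(* The sign of [M] is not known, hence the absolute value. *)
exists `|M| => _ [y /= y1 <-]; apply: le_trans (hM y) _.
apply: le_trans (ler_wpM2r (sqrtr_ge0 _) (ler_norm M)) _.
by rewrite -[leRHS]mulr1 ler_wpM2l.
Qed.

Lemma opnorm_ge0 (A : V -> W) : hbounded_op ipV ipW A -> 0 <= opnorm ipV ipW A.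
Proof.
move=> bA; apply: le_trans (opnorm_ge (x := 0) bA _); first exact: sqrtr_ge0.
by rewrite [hnorm _ _](fnorm0 (rip_hform hV)).
Qed.

Lemma opnorm_bound (A : V -> W) x : hbounded_op ipV ipW A ->
  hnorm ipW (A x) <= opnorm ipV ipW A * hnorm ipV x.
Proof.
move=> bA; have [lA [M hM]] := bA.
have [x0|n0] := eqVneq (hnorm ipV x) 0.
  by have := hM x; rewrite x0 !mulr0.
have np : 0 < hnorm ipV x by rewrite lt_def n0 sqrtr_ge0.
pose r := (hnorm ipV x)^-1.
have cr : cabs r%:C%C = r.
  by rewrite /cabs /= expr0n addr0 sqrtr_sqr ger0_norm // invr_ge0 ltW.
have := opnorm_ge (x := r%:C%C *: x) bA; rewrite (clinearZ lA).
rewrite [hnorm ipV _](fnormZ (rip_hform hV)) [hnorm ipW _](fnormZ (rip_hform hW)).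
rewrite cr -[fnorm _ x]/(hnorm ipV x) mulVf // lexx => /(_ isT).
by rewrite mulrC ler_pdivrMr.
Qed.

End OperatorNorm.

(** * Orthogonal projection onto an embedded Hilbert space *)

Section Subspace.
Context {R : realType} {H K : lmodType R[i]}.
Context {ipH : H -> H -> R[i]} (hH : is_inner_product ipH).
Context {ipK : K -> K -> R[i]} (hK : is_inner_product ipK).
Context {J : H -> K} (hJ : hembedding ipH ipK J).

Let lJ : clinear J. Proof. by case: hJ. Qed.

Lemma rip_embedding x y : rip ipK (J x) (J y) = rip ipH x y.
Proof. by rewrite /rip; case: hJ => _ ->. Qed.

Lemma in_perpD k k' : in_perp ipK J k -> in_perp ipK J k' ->
  in_perp ipK J (k + k').
Proof. by move=> h h' x; rewrite (ipDl hK) h h' addr0. Qed.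

Lemma in_perpP k : in_perp ipK J k <-> forall h, rip ipK k (J h) = 0.
Proof.
split=> [p h|p h]; first by rewrite /rip p.
by apply: (ip_eq0 hK) => //; rewrite -(clinearZ lJ).
Qed.

(** [J h - J h'] is both in the range of [J] and orthogonal to it. *)
Lemma proj_is_unique k h h' : proj_is ipK J k h -> proj_is ipK J k h' -> h = h'.
Proof.
move=> p p'; apply/eqP; rewrite -subr_eq0; apply/eqP/(rip_definite hH).
rewrite -rip_embedding {1}(clinearB lJ) /rip.
have -> : J h - J h' = (k - J h') - (k - J h).
  by rewrite opprB [RHS]addrC addrA subrK.
by rewrite (ipBl hK) p p' subrr.
Qed.

(** The projection is the extension of the identity of [H] along the isometric [J]; completeness of
    [H] provides the limits. *)
Lemma projection_exists : hcomplete ipH ->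
  exists P : K -> H, clinear P /\ forall k, proj_is ipK J k (P k).
Proof.
move=> cH; have gH := rip_hform hH; have gK := rip_hform hK.
have lip x y : fnorm (rip ipH) (id x - id y) <= fnorm (rip ipK) (J (x - y)).
  by rewrite /fnorm rip_embedding.
pose P := ext (q := rip ipK) (j := J) (g := rip ipH) id.
exists P; split; first exact: (ext_linear gK lJ gH cH (rip_definite hH) lip).
move=> k; apply/in_perpP => h; apply/eqP.
rewrite -normr_eq0 eq_le normr_ge0 andbT.
apply: (@le_of_small _ _ _ (2 * fnorm (rip ipK) (J h))) => e e0 _.
have [x hx] := near_proj_exists gK lJ k e0.
have h1 := extP gK lJ gH cH lip (ltW e0) hx.
have h2 := hform_schwarz gK (J (x - P k)) (J h).
have h3 := hx h.
have -> : k - J (P k) = (k - J x) + J (x - P k).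
  by rewrite (clinearB lJ) addrA subrK.
rewrite (hformDl gK) add0r; apply: le_trans (ler_normD _ _) _.
have : fnorm (rip ipK) (J (x - P k)) <= e by rewrite /fnorm rip_embedding.
have := fnorm_ge0 (g := rip ipK) (J h) => n0 h4.
have := ler_wpM2r n0 h4; move: h2 h3; lra.
Qed.

End Subspace.

(** In operator form [P S = T P], from [k = (k - J1 h) + J1 h]; this is how liftings compose. *)
Lemma lifting_proj (R : realType) (H1 K1 H2 K2 : lmodType R[i])
  (ipK1 : K1 -> K1 -> R[i]) (ipK2 : K2 -> K2 -> R[i])
  (J1 : H1 -> K1) (J2 : H2 -> K2) (S : K1 -> K2) (T : H1 -> H2) k h :
  is_inner_product ipK2 -> clinear S -> is_lifting ipK1 ipK2 J1 J2 S T ->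
  proj_is ipK1 J1 k h -> proj_is ipK2 J2 (S k) (T h).
Proof.
move=> hK2 lS [S1 S2] p; rewrite /proj_is -(subrK (J1 h) k) (clinearD lS) -addrA.
by apply: (in_perpD hK2); [exact: S1|exact: S2].
Qed.

(** * The lifting theorem for Hilbert spaces *)

Section Core.
Context {R : realType} {H1 K1 H2 K2 : lmodType R[i]}.
Context {ipH1 : H1 -> H1 -> R[i]} {ipK1 : K1 -> K1 -> R[i]}.
Context {ipH2 : H2 -> H2 -> R[i]} {ipK2 : K2 -> K2 -> R[i]}.
Hypotheses (hH1 : is_hilbert ipH1) (hK1 : is_hilbert ipK1).
Hypotheses (hH2 : is_hilbert ipH2) (hK2 : is_hilbert ipK2).
Context {J1 : H1 -> K1} {J2 : H2 -> K2}.
Hypotheses (hJ1 : hembedding ipH1 ipK1 J1) (hJ2 : hembedding ipH2 ipK2 J2).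
Context {X : H1 -> H2} (hX : hbounded_op ipH1 ipH2 X).

Theorem intertwining_lifting (T : H1 -> H1) (S : H2 -> H2)
  (V : K1 -> K1) (W : K2 -> K2) :
  clinear V -> hisometry ipK1 ipK1 V -> is_lifting ipK1 ipK1 J1 J1 V T ->
  clinear W -> (forall z, hnorm ipK2 (W z) <= hnorm ipK2 z) ->
  is_lifting ipK2 ipK2 J2 J2 W S ->
  (forall h, X (T h) = S (X h)) ->
  exists Y : K1 -> K2,
    [/\ hbounded_op ipK1 ipK2 Y, is_lifting ipK1 ipK2 J1 J2 Y X,
        opnorm ipK1 ipK2 Y = opnorm ipH1 ipH2 X
      & forall k, Y (V k) = W (Y k)].
Proof.
move=> lV isoV liftV lW contrW liftW inter.
have [iH1 cH1] := hH1; have [iK1 cK1] := hK1.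
have [iH2 cH2] := hH2; have [iK2 cK2] := hK2.
have gK1 := rip_hform iK1; have gK2 := rip_hform iK2; have gH1 := rip_hform iH1.
have gH2 := rip_hform iH2.
have lJ1 : clinear J1 by case: hJ1.
have lJ2 : clinear J2 by case: hJ2.
have lX : clinear X by case: hX.
have [P [lP hP]] := projection_exists iH1 iK1 hJ1 cH1.
have PV x : P (V x) = T (P x).
  apply: (proj_is_unique iH1 iK1 hJ1 (hP _)).
  exact: (lifting_proj iK1 lV liftV (hP _)).
have PJ h : P (J1 h) = h.
  by apply: (proj_is_unique iH1 iK1 hJ1 (hP _)) => x; rewrite subrr (ip0l iK1).
set M := opnorm ipH1 ipH2 X; have M0 : 0 <= M by exact: opnorm_ge0.
have sqr_isoV x : rip ipK1 (V x) (V x) = rip ipK1 x x.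
  by rewrite -!fnorm_sqr //; congr (_ ^+ 2); exact: isoV.
have sqr_contrW z : rip ipK2 (W z) (W z) <= rip ipK2 z z.
  rewrite -!fnorm_sqr //; have := contrW z.
  by rewrite -ler_sqr ?nnegrE ?sqrtr_ge0.
pose B x := J2 (X (P x)).
have lB : clinear B by move=> a x y; rewrite /B lP lX lJ2.
pose L y := exists h, y = J2 h.
have boundB x : rip ipK2 (B x) (B x) <= M ^+ 2 * rip ipK1 x x.
  rewrite /B (rip_embedding hJ2).
  have Ple : rip ipH1 (P x) (P x) <= rip ipK1 x x.
    rewrite -(rip_embedding hJ1).
    have pe := (in_perpP iK1 hJ1 _).1 (hP x) (P x).
    have := hform_ge0 gK1 (x - J1 (P x)).
    move: pe; rewrite (hformBl gK1) (hformBl gK1) !(hformBr gK1).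
    by rewrite (hformC gK1 (J1 _) x); lra.
  have := opnorm_bound iH1 iH2 (P x) hX; rewrite -/M.
  rewrite -ler_sqr ?nnegrE ?mulr_ge0 ?sqrtr_ge0 // exprMn.
  rewrite [hnorm _ _ ^+ 2](fnorm_sqr gH2) [hnorm _ _ ^+ 2](fnorm_sqr gH1) => h.
  by apply: le_trans h _; rewrite ler_wpM2l ?sqr_ge0.
pose orth z := forall y, L y -> rip ipK2 z y = 0.
have orthP z : orth z <-> in_perp ipK2 J2 z.
  split=> [h|/(in_perpP iK2 hJ2) h y [x ->]//].
  by apply/(in_perpP iK2 hJ2) => x; apply: h; exists x.
have orthW z : orth z -> orth (W z).
  by move=> /orthP h; apply/orthP; case: liftW => + _; apply.
have BV x : B (V x) = J2 (S (X (P x))) by rewrite /B PV inter.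
have interB x : orth (W (B x) - B (V x)).
  by apply/orthP; rewrite BV; case: liftW => _; apply.
(* [B (V x)] is the component of [W (B x)] in [H2], hence no longer than it. *)
have decrB x : rip ipK2 (B (V x)) (B (V x)) <= rip ipK2 (B x) (B x).
  apply: le_trans (sqr_contrW (B x)).
  have o : rip ipK2 (W (B x) - B (V x)) (B (V x)) = 0.
    by apply: interB; exists (X (P (V x))).
  have := hform_ge0 gK2 (W (B x) - B (V x)).
  move: o; rewrite (hformBl gK2) (hformBl gK2) !(hformBr gK2).
  by rewrite (hformC gK2 (B (V x)) (W _)); lra.
have LB x : L (B x) by exists (X (P x)).
have [Y [lY orthY boundY interY]] :=
  isometry_intertwining_lifting gK1 gK2 cK2 (rip_definite iK2) lV sqr_isoV lW
    sqr_contrW lB LB boundB orthW interB decrB.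
have {}boundY k : hnorm ipK2 (Y k) <= M * hnorm ipK1 k.
  rewrite -ler_sqr ?nnegrE ?mulr_ge0 ?sqrtr_ge0 // exprMn.
  by rewrite [hnorm _ _ ^+ 2](fnorm_sqr gK2) [hnorm _ _ ^+ 2](fnorm_sqr gK1).
have bY : hbounded_op ipK1 ipK2 Y by split=> //; exists M.
have liftY h : proj_is ipK2 J2 (Y (J1 h)) (X h).
  by have /orthP := orthY (J1 h); rewrite /B PJ.
exists Y; split=> //.
  (* On the complement of [H1] the operator [B] vanishes, so [Y k] equals the orthogonal vector
     [Y k - B k]. *)
  split=> // k hk; have Pk : P k = 0.
    apply: (proj_is_unique iH1 iK1 hJ1 (hP k)).
    by rewrite /proj_is (clinear0 lJ1) subr0.
  by have /orthP := orthY k; rewrite /B Pk (clinear0 lX) (clinear0 lJ2) subr0.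
apply/eqP; rewrite eq_le; apply/andP; split; first exact: opnorm_le.
apply: opnorm_le => //; first exact: opnorm_ge0.
(* [X h] is the [H2]-component of [Y (J1 h)], and [J1] preserves norms. *)
move=> h; apply: le_trans (_ : hnorm ipK2 (Y (J1 h)) <= _).
  rewrite ler_wsqrtr // -[leLHS]/(rip ipH2 (X h) (X h)).
  rewrite -[leRHS]/(rip ipK2 (Y (J1 h)) (Y (J1 h))).
  have := (in_perpP iK2 hJ2 _).1 (liftY h) (X h).
  have := hform_ge0 gK2 (Y (J1 h) - J2 (X h)).
  rewrite -(rip_embedding hJ2) (hformBl gK2) (hformBl gK2) !(hformBr gK2).
  by rewrite (hformC gK2 (J2 _) (Y _)); lra.
have := opnorm_bound iK1 iK2 (J1 h) bY.
by rewrite {2}/hnorm; case: hJ1 => _ ->.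
Qed.

Lemma lifting_good_lift (T1 : H1 -> H1) (T2 : H2 -> H2)
  (V1 : K1 -> K1) (V2 : K2 -> K2) (Y : K1 -> K2) :
  clinear V1 -> is_lifting ipK1 ipK1 J1 J1 V1 T1 ->
  clinear V2 -> is_lifting ipK2 ipK2 J2 J2 V2 T2 ->
  hbounded_op ipK1 ipK2 Y -> is_lifting ipK1 ipK2 J1 J2 Y X ->
  opnorm ipK1 ipK2 Y = opnorm ipH1 ipH2 X ->
  good_lift ipH1 ipK1 ipH2 ipK2 J1 J2 T1 T2 V1 V2 X Y.
Proof.
have [[iK1 _] [iK2 _]] := (hK1, hK2).
move=> lV1 liftV1 lV2 liftV2 bY liftY nY; have [lY _] := bY; split=> //.
  elim=> [|n IH] h /=; first by case: liftY.
  exact: (lifting_proj iK2 lV2 liftV2 (IH h)).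
move=> n h; apply: (lifting_proj iK2 lY liftY).
elim: n => [|n IH] /=; first by move=> x; rewrite subrr (ip0l iK1).
exact: (lifting_proj iK1 lV1 liftV1 IH).
Qed.

End Core.

(** * Isometries and inverses of unitaries *)

Section Unitary.
Context {R : realType} {V : lmodType R[i]}.
Context {ip : V -> V -> R[i]} (hip : is_inner_product ip).

(** Polarization with [x + y], enough for the real part. *)
Lemma hisometry_rip (A : V -> V) : clinear A -> hisometry ip ip A ->
  forall x y, rip ip (A x) (A y) = rip ip x y.
Proof.
have g := rip_hform hip => lA iA x y.
have n z : rip ip (A z) (A z) = rip ip z z.
  by rewrite -!fnorm_sqr //; congr (_ ^+ 2); exact: iA.
have := n (x + y); rewrite (clinearD lA) !(hformDl g) !(hformDr g) !n.
by rewrite (hformC g (A y)) (hformC g y); lra.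
Qed.

Lemma hunitary_inverse (A : V -> V) : hunitary ip A -> exists A' : V -> V,
  [/\ cancel A' A, cancel A A', clinear A' & hisometry ip ip A'].
Proof.
move=> [[lA _] iA sA].
have inj : injective A.
  move=> x y e; apply: (fnorm_eq (rip_hform hip) (rip_definite hip) (c := 0)).
  move=> d _ _; rewrite -[fnorm _ _]/(hnorm ip (x - y)) -iA (clinearB lA) e.
  by rewrite subrr mul0r [hnorm _ _](fnorm0 (rip_hform hip)).
pose A' y := projT1 (cid (sA y)).
have AK : cancel A' A by move=> y; exact: projT2 (cid (sA y)).
exists A'; split=> //.
- by move=> x; apply: inj; rewrite AK.
- by move=> a x y; apply: inj; rewrite lA !AK.
- by move=> x; rewrite -iA AK.
Qed.

End Unitary.

Theorem mainTheorem4 (R : realType) (H1 K1 H2 K2 : lmodType R[i])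
  (ipH1 : H1 -> H1 -> R[i]) (ipK1 : K1 -> K1 -> R[i])
  (ipH2 : H2 -> H2 -> R[i]) (ipK2 : K2 -> K2 -> R[i])
  (hH1 : is_hilbert ipH1) (hK1 : is_hilbert ipK1)
  (hH2 : is_hilbert ipH2) (hK2 : is_hilbert ipK2)
  (J1 : H1 -> K1) (J2 : H2 -> K2)
  (hJ1 : hembedding ipH1 ipK1 J1) (hJ2 : hembedding ipH2 ipK2 J2)
  (T1 : H1 -> H1) (T2 : H2 -> H2)
  (hT1 : hcontraction ipH1 ipH1 T1) (hT2 : hcontraction ipH2 ipH2 T2)
  (V1 : K1 -> K1) (V2 : K2 -> K2)
  (hV1 : [/\ hbounded_op ipK1 ipK1 V1, hisometry ipK1 ipK1 V1
           & is_lifting ipK1 ipK1 J1 J1 V1 T1])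
  (hV2 : [/\ hbounded_op ipK2 ipK2 V2, hisometry ipK2 ipK2 V2
           & is_lifting ipK2 ipK2 J2 J2 V2 T2])
  (X : H1 -> H2) (hX : hbounded_op ipH1 ipH2 X) :
  (forall (Q : H2 -> H2) (Qbar : K2 -> K2),
     hcontraction ipH2 ipH2 Q -> hcontraction ipK2 ipK2 Qbar ->
     reduces_to ipK2 J2 Qbar Q ->
     ((forall h, X (T1 h) = Q (T2 (X h))) ->
        exists Y : K1 -> K2,
          good_lift ipH1 ipK1 ipH2 ipK2 J1 J2 T1 T2 V1 V2 X Y /\
          forall k, Y (V1 k) = Qbar (V2 (Y k)))
     /\
     ((forall h, X (T1 h) = T2 (Q (X h))) ->
        exists Y : K1 -> K2,
          good_lift ipH1 ipK1 ipH2 ipK2 J1 J2 T1 T2 V1 V2 X Y /\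
          forall k, Y (V1 k) = V2 (Qbar (Y k))))
  /\
  (forall (Q : H1 -> H1) (Qbar : K1 -> K1),
     hunitary ipH1 Q -> hunitary ipK1 Qbar ->
     reduces_to ipK1 J1 Qbar Q ->
     (forall h, X (T1 h) = T2 (X (Q h))) ->
        exists Y : K1 -> K2,
          good_lift ipH1 ipK1 ipH2 ipK2 J1 J2 T1 T2 V1 V2 X Y /\
          forall k, Y (V1 k) = V2 (Y (Qbar k))).
Proof.
have [[lV1 _] isoV1 liftV1] := hV1; have [[lV2 _] isoV2 liftV2] := hV2.
have [[iH1 _] [iK1 _] [iK2 _]] := And3 hH1 hK1 hK2.
have good Y := lifting_good_lift (Y := Y) hK1 hK2 lV1 liftV1 lV2 liftV2.
split=> [Q Qbar _ [[lQb _] cQb] redQ|Q Qbar uQ uQb redQ inter].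
  have [QJ Qperp] := redQ.
  (* Reduction makes [Qbar] a lifting of [Q], so its products with [V2] lift those of [Q] with
     [T2]. *)
  have liftQ : is_lifting ipK2 ipK2 J2 J2 Qbar Q.
    by split=> // h x; rewrite QJ subrr (ip0l iK2).
  split=> inter.
    have lW : clinear (Qbar \o V2) by move=> a x y; rewrite /= lV2 lQb.
    have [z||Y [bY liftY nY interY]] :=
      intertwining_lifting (W := Qbar \o V2) (S := Q \o T2) hH1 hK1 hH2 hK2
        hJ1 hJ2 hX lV1 isoV1 liftV1 lW _ _ inter.
    - by apply: le_trans (cQb _) _; rewrite isoV2.
    - split=> [k|h]; first by move=> /liftV2.1/Qperp.
      exact: (lifting_proj iK2 lQb liftQ (liftV2.2 h)).
    by exists Y; split; [exact: good|exact: interY].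
  have lW : clinear (V2 \o Qbar) by move=> a x y; rewrite /= lQb lV2.
  have [z||Y [bY liftY nY interY]] :=
    intertwining_lifting (W := V2 \o Qbar) (S := T2 \o Q) hH1 hK1 hH2 hK2
      hJ1 hJ2 hX lV1 isoV1 liftV1 lW _ _ inter.
  - by rewrite /= isoV2.
  - split=> [k|h]; first by move=> /Qperp/liftV2.1.
    exact: (lifting_proj iK2 lV2 liftV2 (liftQ.2 h)).
  by exists Y; split; [exact: good|exact: interY].
have [QJ _] := redQ; have [[lQb _] isoQb _] := uQb.
have [Q' [Q'K _ _ _]] := hunitary_inverse iH1 uQ.
have [Qb' [Qb'K QbK lQb' isoQb']] := hunitary_inverse iK1 uQb.
have lV : clinear (V1 \o Qb') by move=> a x y; rewrite /= lQb' lV1.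
have isoV : hisometry ipK1 ipK1 (V1 \o Qb') by move=> x; rewrite /= isoV1.
have liftV : is_lifting ipK1 ipK1 J1 J1 (V1 \o Qb') (T1 \o Q').
  split=> [k hk|h] /=.
    apply: liftV1.1; apply/(in_perpP iK1 hJ1) => h.
    (* Applying [Qbar] to both arguments turns the pairing of [Qb' k] with [J1 h] into that of [k]
       with [J1 (Q h)]. *)
    rewrite -(hisometry_rip iK1 lQb isoQb) Qb'K QJ.
    exact: ((in_perpP iK1 hJ1 k).1 hk).
  have -> : Qb' (J1 h) = J1 (Q' h) by rewrite -{1}(Q'K h) -QJ QbK.
  exact: liftV1.2.
have contrV2 z : hnorm ipK2 (V2 z) <= hnorm ipK2 z by rewrite isoV2.
have [|Y [bY liftY nY interY]] :=
  intertwining_lifting hH1 hK1 hH2 hK2 hJ1 hJ2 hX lV isoV liftV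
    lV2 contrV2 liftV2.
  by move=> h /=; rewrite inter Q'K.
exists Y; split; first exact: good.
(* The relation [Y V1 Qbar^-1 = V2 Y] is read at [Qbar k]. *)
by move=> k; rewrite -interY /= QbK.
Qed.
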